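(* Let $k$ be a commutative ring, let $\mathcal{D}$ be a small category, and let $\mu$ be a homological modulus for $\mathcal{D}$ over $k$ (the sets $\mu(d)$ are not required to be finite). Let $\{d_i\}_{i\in I}$ be a (possibly infinite) family of objects of $\mathcal{D}$. Then representations of $\mathcal{D}$ over $k$ generated in degrees $\{d_i\}_{i\in I}$ are determined up to isomorphism by their restrictions to the full subcategory $\mathcal{E}$ of $\mathcal{D}$ spanned by the objects $\bigcup_{i\in I}\mu(d_i)$. That is, if $V$ and $W$ are representations of $\mathcal{D}$, each generated in degrees $\{d_i\}_{i\in I}$, and their restrictions $V|_{\mathcal{E}}$ and $W|_{\mathcal{E}}$ are isomorphic, then $V$ and $W$ are isomorphic.
   Context: A representation of $\mathcal{D}$ over $k$ is a functor $V:\mathcal{D}\to\mathrm{Mod}_k$; maps are natural transformations, and subrepresentations are formed objectwise. $V$ is generated in degrees $\{d_i\}_{i\in I}$ if any subrepresentation $W\subseteq V$ with $W(d_i)=V(d_i)$ for all $i\in I$ equals $V$. For objects $x,y\in\mathcal{D}$, let $S(x,y)$ be the set of morphisms $x\to x$ that factor through $y$. For $d\in\mathcal{D}$ and $s\in S(x,y)$, let $M_s$ be the square $0$-$1$ matrix over $k$ with rows and columns indexed by $\operatorname{Hom}_{\mathcal{D}}(d,x)$, whose $(f,g)$ entry is $1$ if $s\circ f=g$ and $0$ otherwise. Write $x\leq_d y$ if the identity matrix lies in the $k$-span (finite $k$-linear combinations) of the matrices $M_s$, $s\in S(x,y)$. In this statement a homological modulus for $\mathcal{D}$ over $k$ is a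 function $\mu$ from objects of $\mathcal{D}$ to (not necessarily finite) subsets of $\operatorname{Ob}(\mathcal{D})$ such that for every $d,x\in\mathcal{D}$ there exists $y\in\mu(d)$ with $x\leq_d y$. No finiteness of hom-sets and no Artinian hypothesis on $k$ is assumed. *)

(* Defs.v *)
From HB Require Import structures.
From mathcomp Require Import all_boot all_algebra.
From mathcomp Require Import boolp classical_sets.

Set Implicit Arguments.
Unset Strict Implicit.
Unset Printing Implicit Defensive.

Import GRing.Theory.
Local Open Scope classical_set_scope.
Local Open Scope ring_scope.

(* [compm g f] is "g after f". *)
Record category := Category {
  obj :> Type;
  hom : obj -> obj -> Type;
  idm : forall x : obj, hom x x;
  compm : forall x y z : obj, hom y z -> hom x y -> hom x z;
  compm1 : forall (x y : obj) (f : hom x y), compm f (idm x) = f;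
  comp1m : forall (x y : obj) (f : hom x y), compm (idm y) f = f;
  compmA : forall (w x y z : obj) (h : hom y z) (g : hom x y) (f : hom w x),
    compm h (compm g f) = compm (compm h g) f
}.

Arguments hom {c} _ _.
Arguments idm {c} x.
Arguments compm {c x y z} _ _.

Definition full_subcategory (D : category) (P : set D) : category :=
  @Category {x : D | P x}
    (fun x y => hom (sval x) (sval y))
    (fun x => idm (sval x))
    (fun x y z g f => compm g f)
    (fun x y f => compm1 f)
    (fun x y f => comp1m f)
    (fun w x y z h g f => compmA h g f).

Record representation (k : comPzRingType) (D : category) := Representation {
  rep_obj :> D -> lmodType k;
  rep_map : forall x y : D, hom x y -> {linear rep_obj x -> rep_obj y};
  rep_map1 : forall (x : D) (v : rep_obj x), rep_map (idm x) v = v;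
  rep_mapM : forall (x y z : D) (g : hom y z) (f : hom x y) (v : rep_obj x),
    rep_map (compm g f) v = rep_map g (rep_map f v)
}.

Arguments rep_map {k D} r {x y} _.

Definition restriction (k : comPzRingType) (D : category)
    (V : representation k D) (P : set D) :
    representation k (full_subcategory P) :=
  @Representation k (full_subcategory P)
    (fun x => V (sval x))
    (fun x y f => rep_map V f)
    (fun x v => @rep_map1 k D V (sval x) v)
    (fun x y z g f v => @rep_mapM k D V (sval x) (sval y) (sval z) g f v).

Record rep_morphism (k : comPzRingType) (D : category)
    (V W : representation k D) := RepMorphism {
  mor_at :> forall x : D, {linear V x -> W x};
  mor_natural : forall (x y : D) (f : hom x y) (v : V x),
    mor_at y (rep_map V f v) = rep_map W f (mor_at x v)
}.

Arguments mor_at {k D V W} r x.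

Definition rep_isomorphic (k : comPzRingType) (D : category)
    (V W : representation k D) : Prop :=
  exists (phi : rep_morphism V W) (psi : rep_morphism W V),
    (forall x : D, cancel (phi x) (psi x)) /\
    (forall x : D, cancel (psi x) (phi x)).

(* Under the classical axioms of boolp, boolean predicates on a module are the
   same thing as arbitrary subsets of it. *)
Record subrepresentation (k : comPzRingType) (D : category)
    (V : representation k D) := Subrepresentation {
  sub_at :> forall x : D, {pred V x};
  sub_submod : forall x : D, GRing.submod_closed (@sub_at x);
  sub_map : forall (x y : D) (f : hom x y) (v : V x),
    v \in @sub_at x -> rep_map V f v \in @sub_at y
}.

Arguments sub_at {k D V} s x.

Definition generated_in_degrees (k : comPzRingType) (D : category)
    (V : representation k D) (I : Type) (d : I -> D) : Prop :=
  forall U : subrepresentation V,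
    (forall i : I, U (d i) =i predT) -> forall x : D, U x =i predT.

Definition endo_through (D : category) (x y : D) : set (hom x x) :=
  [set s | exists (a : hom x y) (b : hom y x), s = compm b a].

(* Square matrices indexed by the possibly infinite set [hom d x] are functions
   of two arguments. *)
Definition endo_matrix (k : comPzRingType) (D : category) (d x : D)
    (s : hom x x) : hom d x -> hom d x -> k :=
  fun f g => `[< compm s f = g >]%:R.

Definition identity_matrix (k : comPzRingType) (T : Type) : T -> T -> k :=
  fun f g => `[< f = g >]%:R.

Definition le_at (k : comPzRingType) (D : category) (d x y : D) : Prop :=
  exists (n : nat) (c : 'I_n -> k) (s : 'I_n -> hom x x),
    (forall i : 'I_n, endo_through y (s i)) /\
    (forall f g : hom d x,
       identity_matrix k f g = \sum_(i < n) c i * endo_matrix k (s i) f g).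

Definition homological_modulus (k : comPzRingType) (D : category)
    (mu : D -> set D) : Prop :=
  forall d x : D, exists2 y : D, mu d y & le_at k d x y.

(* Main.v *)
From Pilot Require Import Defs.
From HB Require Import structures.
From mathcomp Require Import all_boot all_algebra.
From mathcomp Require Import boolp classical_sets.

(** Let [P] be the set of objects of the full subcategory.  A representation
    generated in the degrees [d i] is controlled by [P] from both sides.

    It is generated by its values on [P].  The relation from [d i] to itself
    through an object [y] of [P], read at the identity of [d i], writes every
    vector over [d i] as a combination of vectors coming from [y]
    ([generated_from_through]).

    It is cogenerated by its values on [P]: a vector killed by every morphism
    into [P] is zero ([eq0_of_invisible]).  For a fixed [i], the relation
    at [x] gives a combination [e] of endomorphisms of [x] that factor through
    [P], and [e] fixes everything that comes from [d i].  Thus [1 - e] kills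
    what comes from [d i] but fixes the vectors that [P] does not see.  A vector
    of a representation generated in infinitely many degrees involves only
    finitely many of them, and a product of finitely many factors [1 - e] kills
    all their contributions, because each factor preserves subrepresentations.
    So an unseen vector is both fixed and killed.

    Hence a morphism [phi] of restrictions to [P] extends uniquely: the image of
    [v] is the only [w] whose images under all morphisms into [P] are those
    prescribed by [phi] ([extend_morphism]).  Generation of the source gives
    existence, cogeneration of the target gives uniqueness, linearity and
    naturality.  The extensions of two mutually inverse morphisms are inverse to
    each other, again by cogeneration. *)

Set Implicit Arguments.
Unset Strict Implicit.
Unset Printing Implicit Defensive.

(* Morphisms of a category, not linear maps of vector spaces, are meant by [hom]. *)
Import Pilot.Defs.
Import GRing.Theory.
Local Open Scope classical_set_scope.
Local Open Scope ring_scope.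

(** Subrepresentations as families of propositional predicates, which spares
    the passage through boolean membership. *)
Record subrep_family (k : comPzRingType) (D : category)
    (V : representation k D) (Q : forall x : D, V x -> Prop) : Prop :=
  SubrepFamily {
    subrep0 : forall x : D, Q x 0;
    subrep_linear : forall (x : D) (a : k) (u v : V x),
      Q x u -> Q x v -> Q x (a *: u + v);
    subrep_map : forall (x y : D) (f : hom x y) (v : V x),
      Q x v -> Q y (rep_map V f v)
  }.

Lemma subrep_sum (k : comPzRingType) (D : category) (V : representation k D)
    (Q : forall x : D, V x -> Prop) (x : D) (n : nat) (c : 'I_n -> k)
    (u : 'I_n -> V x) :
  subrep_family Q -> (forall i, Q x (u i)) -> Q x (\sum_(i < n) c i *: u i).
Proof.
move=> subQ Qu; elim/big_rec: _ => [|i t _ Qt]; first exact: subrep0.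
exact: subrep_linear.
Qed.

Lemma generated_ind (k : comPzRingType) (D : category) (V : representation k D)
    (I : Type) (d : I -> D) (Q : forall x : D, V x -> Prop) :
  generated_in_degrees V d -> subrep_family Q ->
  (forall (i : I) (v : V (d i)), Q (d i) v) -> forall (x : D) (v : V x), Q x v.
Proof.
move=> genV subQ Qd x v.
pose S (z : D) : {pred V z} := fun u => `[< Q z u >].
have Ssub z : GRing.submod_closed (S z).
  split=> [|a u w /asboolP Qu /asboolP Qw]; apply/asboolP.
    exact: subrep0.
  exact: subrep_linear.
have Smap z y (f : hom z y) (u : V z) : u \in S z -> rep_map V f u \in S y.
  by move=> /asboolP Qu; apply/asboolP; apply: subrep_map.
have full i : Subrepresentation Ssub Smap (d i) =i predT.
  by move=> u; apply/idP/asboolP.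
by have /asboolP : v \in S x by have := genV _ full x v.
Qed.

(** The matrix identity says that the formal combination of the [s i] fixes the
    basis vector of every [f]; here it is evaluated in a representation. *)
Lemma matrix_identity_act (k : comPzRingType) (D : category)
    (V : representation k D) (d x : D) (n : nat) (c : 'I_n -> k)
    (s : 'I_n -> hom x x) :
  (forall f g : hom d x,
     identity_matrix k f g = \sum_(i < n) c i * endo_matrix k (s i) f g) ->
  forall (f : hom d x) (v : V d),
    \sum_(i < n) c i *: rep_map V (s i) (rep_map V f v) = rep_map V f v.
Proof.
move=> idE f v.
(* Row [f] of the matrices is supported on the finite list of [f] and all
   [compm (s i) f], so it can be summed against the images of [v]. *)
pose C : choiceType := {classic hom d x}.
pose h (i : 'I_n) : C := compm (s i) f.
have sum_row (T : C) (r : seq C) : uniq r -> T \in r ->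
    \sum_(g <- r) (`[< T = g >]%:R : k) *: rep_map V g v = rep_map V T v.
  move=> ur Tr; rewrite (bigD1_seq _ Tr ur) /= big1 ?addr0.
    by rewrite asboolT // scale1r.
  move=> g /eqP gT; rewrite asboolF ?scale0r // => Tg.
  by apply: gT; rewrite Tg.
pose r : seq C := undup ((f : C) :: codom h).
have ur : uniq r by exact: undup_uniq.
have fr : (f : C) \in r by rewrite mem_undup mem_head.
have hr i : h i \in r by rewrite mem_undup in_cons codom_f orbT.
rewrite -[RHS](sum_row f r ur fr).
under [RHS]eq_bigr => g _.
  have -> : (`[< f = g >]%:R : k) = \sum_(i < n) c i * endo_matrix k (s i) f g.
    exact: idE.
  rewrite scaler_suml.
  over.
rewrite exchange_big /=; apply: eq_bigr => i _.
rewrite -rep_mapM -(sum_row (h i) r ur (hr i)) scaler_sumr.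
by apply: eq_bigr => g _; rewrite scalerA.
Qed.

(** What a homological modulus [mu] gives when [P] is the union of the
    [mu (d i)]. *)
Definition passes_through (k : comPzRingType) (D : category) (P : set D)
    (I : Type) (d : I -> D) : Prop :=
  forall (i : I) (x : D), exists2 y : D, P y & le_at k (d i) x y.

Lemma generated_from_through (k : comPzRingType) (D : category) (P : set D)
    (I : Type) (d : I -> D) (V : representation k D)
    (Q : forall x : D, V x -> Prop) :
  passes_through k P d -> generated_in_degrees V d -> subrep_family Q ->
  (forall (y : D) (v : V y), P y -> Q y v) -> forall (x : D) (v : V x), Q x v.
Proof.
move=> thP genV subQ QP; apply: (generated_ind genV) => // i v.
have [y Py [n [c [s [sy idE]]]]] := thP i (d i).
have := matrix_identity_act idE (idm (d i)) v; rewrite rep_map1 => <-.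
apply: subrep_sum => // j; have [a [b ->]] := sy j.
by rewrite rep_mapM; apply: subrep_map => //; apply: QP.
Qed.

(** The largest subrepresentation that restricts to zero on [P]. *)
Definition invisible (k : comPzRingType) (D : category) (P : set D)
    (V : representation k D) (x : D) (v : V x) : Prop :=
  forall (y : D) (a : hom x y), P y -> rep_map V a v = 0.

(** The operators [N] abstract the products of factors [1 - e], where [e] is a
    combination of endomorphisms of [y] that factor through [P].  Acting through
    endomorphisms of [y] is recorded as preserving every subrepresentation,
    which is stable under composition without any computation with formal
    combinations of morphisms.  One [N] serves all the images of [v] in [y],
    since this is what survives in a sum. *)
Definition sieved (k : comPzRingType) (D : category) (P : set D)
    (V : representation k D) (x : D) (v : V x) : Prop :=
  forall y : D, exists N : {linear V y -> V y},
    [/\ forall Q : forall z : D, V z -> Prop, subrep_family Q ->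
          forall u : V y, Q y u -> Q y (N u),
        forall u : V y, invisible P u -> N u = u
      & forall g : hom x y, N (rep_map V g v) = 0].

(** For a sum, the operators of the two summands are composed.  The inner one
    kills the images of one summand, and moves the images of the other one inside
    the subrepresentation of all vectors whose images in [y] the outer one
    kills. *)
Lemma sieved_subrep (k : comPzRingType) (D : category) (P : set D)
    (V : representation k D) : subrep_family (@sieved k D P V).
Proof.
split=> [x y|x a u v su sv y|x y f v sv z].
- exists idfun; split=> // g; exact: linear0.
- have [N1 [N1sub N1inv N1u]] := su y; have [N2 [N2sub N2inv N2v]] := sv y.
  exists (N1 \o N2); split=> [Q subQ w Qw|w w0|g] /=.
  + by apply: N1sub => //; apply: N2sub.
  + by rewrite N2inv // N1inv.
  + rewrite !linearP /= N2v linear0 addr0.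
    pose Q (z : D) (w : V z) := forall h : hom z y, N1 (rep_map V h w) = 0.
    have subQ : subrep_family Q.
      split=> [z h|z b w t Qw Qt h|z t h w Qw h'].
      * by rewrite !linear0.
      * by rewrite !linearP /= Qw Qt scaler0 addr0.
      * by rewrite -rep_mapM.
    have Qgu : Q y (rep_map V g u) by apply: (subrep_map subQ).
    have := N2sub Q subQ _ Qgu (idm y).
    by rewrite rep_map1 => ->; rewrite scaler0.
- have [N [Nsub Ninv Nv]] := sv z.
  by exists N; split=> // g; rewrite -rep_mapM.
Qed.

Lemma sieved_degree (k : comPzRingType) (D : category) (P : set D)
    (I : Type) (d : I -> D) (V : representation k D) (i : I) (v : V (d i)) :
  passes_through k P d -> sieved P v.
Proof.
move=> thP x; have [y Py [n [c [s [sy idE]]]]] := thP i x.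
pose N (u : V x) : V x := u - \sum_(j < n) c j *: rep_map V (s j) u.
have Nlin : linear N.
  move=> a u w; rewrite /N scalerBr addrACA -opprD; congr (_ - _).
  rewrite scaler_sumr -big_split; apply: eq_bigr => j _ /=.
  by rewrite linearP scalerDr !scalerA mulrC.
pose NL := GRing.isLinear.Build k (V x) (V x) *:%R N Nlin.
pose N' : {linear V x -> V x} := HB.pack N NL.
exists N'; split=> [Q subQ u Qu|u u0|g]; rewrite /= /N.
- rewrite addrC -scaleN1r; apply: subrep_linear => //.
  by apply: subrep_sum => // j; apply: subrep_map.
- rewrite big1 ?subr0 // => j _; have [a [b ->]] := sy j.
  by rewrite rep_mapM u0 // linear0 scaler0.
- by rewrite (matrix_identity_act idE) subrr.
Qed.

Lemma eq0_of_invisible (k : comPzRingType) (D : category) (P : set D)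
    (I : Type) (d : I -> D) (V : representation k D) (x : D) (v : V x) :
  passes_through k P d -> generated_in_degrees V d -> invisible P v -> v = 0.
Proof.
move=> thP genV v0.
have : sieved P v.
  apply: (generated_ind genV (sieved_subrep P V)) => i u.
  exact: sieved_degree thP.
by move=> /(_ x)[N [_ Ninv /(_ (idm x))]]; rewrite rep_map1 Ninv.
Qed.

Lemma eq_of_visible (k : comPzRingType) (D : category) (P : set D)
    (I : Type) (d : I -> D) (V : representation k D) (x : D) (u v : V x) :
  passes_through k P d -> generated_in_degrees V d ->
  (forall (y : D) (a : hom x y), P y -> rep_map V a u = rep_map V a v) -> u = v.
Proof.
move=> thP genV uv; apply/eqP; rewrite -subr_eq0; apply/eqP.
apply: (eq0_of_invisible thP genV) => y a Py.
by rewrite linearB uv // subrr.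
Qed.

(** Seen from [P], the vector [w] is the image of [v] under [phi].  The image of
    [v] is defined by this relation and not by an expression of [v] through
    vectors over [P], so that no choice of such an expression enters. *)
Definition corresponds (k : comPzRingType) (D : category) (P : set D)
    (V W : representation k D)
    (phi : rep_morphism (restriction V P) (restriction W P))
    (x : D) (v : V x) (w : W x) : Prop :=
  forall (y : D) (Py : P y) (a : hom x y),
    rep_map W a w = phi (exist _ y Py) (rep_map V a v).

Lemma corresponds_total (k : comPzRingType) (D : category) (P : set D)
    (I : Type) (d : I -> D) (V W : representation k D)
    (phi : rep_morphism (restriction V P) (restriction W P)) :
  passes_through k P d -> generated_in_degrees V d ->
  forall (x : D) (v : V x), exists w : W x, corresponds phi v w.
Proof.
move=> thP genV; apply: (generated_from_through thP genV).
  split=> [x|x a u v [u' uu'] [v' vv']|x y f v [w vw]].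
  - by exists 0 => y Py a; rewrite !linear0.
  - exists (a *: u' + v') => y Py b.
    by rewrite !linearP /= (uu' _ Py) (vv' _ Py).
  - by exists (rep_map W f w) => z Pz a; rewrite -!rep_mapM; apply: vw.
move=> y v Py; exists (phi (exist _ y Py) v) => z Pz a.
exact: esym (@mor_natural _ _ _ _ phi (exist _ y Py) (exist _ z Pz) a v).
Qed.

Lemma extend_morphism (k : comPzRingType) (D : category) (P : set D)
    (I : Type) (d : I -> D) (V W : representation k D)
    (phi : rep_morphism (restriction V P) (restriction W P)) :
  passes_through k P d -> generated_in_degrees V d ->
  generated_in_degrees W d ->
  exists Phi : rep_morphism V W,
    forall (x : D) (v : V x), corresponds phi v (Phi x v).
Proof.
move=> thP genV genW.
have tot x := boolp.choice (corresponds_total phi thP genV (x := x)).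
pose F x : V x -> W x := projT1 (tot x).
have FE x v : corresponds phi v (F x v) by exact: (projT2 (tot x) v).
have Flin x : linear (F x).
  move=> a u v; apply: (eq_of_visible thP genW) => y b Py.
  by rewrite linearP /= !(FE _ _ _ Py) !linearP.
pose L x : {linear V x -> W x} :=
  HB.pack (F x) (GRing.isLinear.Build k (V x) (W x) *:%R (F x) (Flin x)).
have Lnat x y (f : hom x y) (v : V x) :
    L y (rep_map V f v) = rep_map W f (L x v).
  apply: (eq_of_visible thP genW) => z b Pz /=.
  by rewrite (FE _ _ _ Pz) -!rep_mapM (FE _ _ _ Pz).
by exists (RepMorphism Lnat) => x v; apply: FE.
Qed.

Lemma extension_cancel (k : comPzRingType) (D : category) (P : set D)
    (I : Type) (d : I -> D) (V W : representation k D)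
    (phi : rep_morphism (restriction V P) (restriction W P))
    (psi : rep_morphism (restriction W P) (restriction V P))
    (Phi : rep_morphism V W) (Psi : rep_morphism W V) :
  passes_through k P d -> generated_in_degrees V d ->
  (forall (x : D) (v : V x), corresponds phi v (Phi x v)) ->
  (forall (x : D) (w : W x), corresponds psi w (Psi x w)) ->
  (forall x, cancel (phi x) (psi x)) -> forall x, cancel (Phi x) (Psi x).
Proof.
move=> thP genV PhiE PsiE phiK x v.
apply: (eq_of_visible thP genV) => y a Py.
by rewrite (PsiE _ _ _ Py) (PhiE _ _ _ Py) phiK.
Qed.

Theorem theorem1p10 (k : comPzRingType) (D : category) (mu : D -> set D)
    (hmu : homological_modulus k mu) (I : Type) (d : I -> D)
    (V W : representation k D)
    (hV : generated_in_degrees V d) (hW : generated_in_degrees W d)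
    (hVW : rep_isomorphic (restriction V (\bigcup_(i in [set: I]) mu (d i)))
                          (restriction W (\bigcup_(i in [set: I]) mu (d i)))) :
  rep_isomorphic V W.
Proof.
have thP : passes_through k (\bigcup_(i in [set: I]) mu (d i)) d.
  by move=> i x; have [y muy le_xy] := hmu (d i) x; exists y => //; exists i.
have [phi [psi [phiK psiK]]] := hVW.
have [Phi PhiE] := extend_morphism phi thP hV hW.
have [Psi PsiE] := extend_morphism psi thP hW hV.
exists Phi, Psi; split.
  exact: extension_cancel thP hV PhiE PsiE phiK.
exact: extension_cancel thP hW PsiE PhiE psiK.
Qed.
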